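(* Let $\Pi_1,\Pi_2$ be torsion free groups, and let $\Gamma_1\trianglelefteq\Pi_1$, $\Gamma_2\trianglelefteq\Pi_2$ be normal subgroups which are polycyclic and such that $\Pi_1/\Gamma_1$ and $\Pi_2/\Gamma_2$ are finite. Let $\varphi,\psi:\Pi_1\to\Pi_2$ be homomorphisms with $\varphi(\Gamma_1)\subset\Gamma_2$ and $\psi(\Gamma_1)\subset\Gamma_2$, and let $\varphi',\psi':\Gamma_1\to\Gamma_2$ be their restrictions. If $\Gamma_1$ and $\Gamma_2$ have the same Hirsch length, then $$R(\varphi,\psi)=\frac{1}{[\Pi_1:\Gamma_1]}\sum_{\bar\alpha\in\Pi_2/\Gamma_2}R(\tau_\alpha\varphi',\psi').$$
   Context: For group homomorphisms $\varphi,\psi:G_1\to G_2$, define an equivalence relation on $G_2$ by $\alpha\sim\beta$ iff $\beta=\psi(\gamma)\alpha\varphi(\gamma)^{-1}$ for some $\gamma\in G_1$. The Reidemeister coincidence number $R(\varphi,\psi)$ is the number of equivalence classes, taken to be $\infty$ if there are infinitely many. For $\bar\alpha\in\Pi_2/\Gamma_2$, $\alpha\in\Pi_2$ denotes any element projecting to $\bar\alpha$, $\tau_\alpha$ is conjugation $x\mapsto\alpha x\alpha^{-1}$, and $\tau_\alpha\varphi':\Gamma_1\to\Gamma_2$ is the homomorphism $\gamma\mapsto\alpha\varphi'(\gamma)\alpha^{-1}$. The equality is understood in $\{1,2,3,\dots\}\cup\{\infty\}$ (both sides may be $\infty$). *)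

(* Defs.v *)
From HB Require Import structures.
From mathcomp Require Import all_boot all_order all_algebra.
From mathcomp Require Import finmap boolp classical_sets functions cardinality fsbigop.
From mathcomp Require Import constructive_ereal ereal.

Set Implicit Arguments.
Unset Strict Implicit.
Unset Printing Implicit Defensive.

Import Order.TTheory GRing.Theory Num.Theory.

Local Open Scope classical_set_scope.
Local Open Scope group_scope.

(** Groups are [groupType]s, possibly infinite, and homomorphisms are
    [{multiplicative G -> H}].  A subgroup of [G] is a [groupClosed G]; the
    predicates are boolean, which classically is no restriction. *)

Section Groups.
Variable G : groupType.

Definition torsion_free : Prop :=
  forall (x : G) (n : nat), (0 < n)%N -> x ^+ n = 1 -> x = 1.

Definition normal_in (K H : {pred G}) : Prop :=
  {subset K <= H} /\ {in K & H, forall x y, y * x * y^-1 \in K}.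

(** The left cosets [x K] with [x \in H]; when [normal_in K H] this is the
    underlying set of [H / K]. *)
Definition cosets_in (K H : {pred G}) : set (set G) :=
  [set [set x * k | k in [set` K]] | x in [set` H]].

(** [0] when [H / K] is infinite. *)
Definition index_in (K H : {pred G}) : nat := #|` fset_set (cosets_in K H)|%N.

Definition expgz (x : G) (m : int) : G :=
  match m with Posz n => x ^+ n | Negz n => x ^- n.+1 end.

(** [H / K] is generated by the class of a single element. *)
Definition cyclic_factor (K H : {pred G}) : Prop :=
  exists2 g, g \in H &
    forall x, x \in H -> exists m : int, (expgz g m)^-1 * x \in K.

(** [G = S 0 >= S 1 >= ... >= S n = 1], each term normal in the previous one
    with cyclic factor; the values of [S] beyond [n] are irrelevant. *)
Definition polycyclic_series (n : nat) (S : nat -> groupClosed G) : Prop :=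
  [/\ forall x, x \in S 0%N,
      forall x, (x \in S n) = (x == 1) &
      forall i, (i < n)%N ->
        normal_in (S i.+1) (S i) /\ cyclic_factor (S i.+1) (S i)].

Definition polycyclic : Prop := exists n S, polycyclic_series n S.

Definition num_infinite_factors (n : nat) (S : nat -> groupClosed G) : nat :=
  #|[set i : 'I_n | `[< infinite_set (cosets_in (S i.+1) (S i)) >] ]%SET|.

(** The number of infinite cyclic factors of a polycyclic series.  It does not
    depend on the series, so choosing one with [xget] is harmless; the value is
    [0] if [G] is not polycyclic. *)
Definition hirsch_length : nat :=
  xget 0%N [set h | exists n S,
    polycyclic_series n S /\ h = num_infinite_factors n S].

End Groups.

Section Subgroup.
Variables (G : groupType) (H : groupClosed G).

Definition subg : Type := {x : G | x \in H}.

HB.instance Definition _ := SubChoice.on subg.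

Lemma subg_closed : group_closed (fun x : G => x \in H).
Proof. by split=> [|x y xH yH]; [exact: gpred1 | exact: gpredF]. Qed.

HB.instance Definition _ :=
  SubChoice_isSubGroup.Build G (fun x : G => x \in H) subg subg_closed.

End Subgroup.

Section Restriction.
Variables (G1 G2 : groupType) (H1 : groupClosed G1) (H2 : groupClosed G2).
Variables (f : {multiplicative G1 -> G2}).
Hypothesis fH : {in H1, forall x, f x \in H2}.

Definition restr (x : subg H1) : subg H2 := Sub (f (val x)) (fH (valP x)).

Lemma restrM : {morph restr : x y / x * y}.
Proof. by move=> x y; apply: val_inj; rewrite /= gmulfM. Qed.

HB.instance Definition _ := isMultiplicative.Build _ _ restr restrM.

End Restriction.

Section Conjugation.
Variables (G : groupType) (H : groupClosed G).
Hypothesis nH : normal_in H predT.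

Lemma tau_subproof (a : G) (x : subg H) : a * val x * a^-1 \in H.
Proof. exact: (nH.2 _ _ (valP x)). Qed.

(** Conjugation by an element [a] of the ambient group, on a normal subgroup. *)
Definition tau (a : G) (x : subg H) : subg H :=
  Sub (a * val x * a^-1) (tau_subproof a x).

Lemma tauM (a : G) : {morph tau a : x y / x * y}.
Proof.
by move=> x y; apply: val_inj; rewrite /= !mulgA mulgVK.
Qed.

HB.instance Definition _ a := isMultiplicative.Build _ _ (tau a) (@tauM a).

End Conjugation.

Definition ecard (T : choiceType) (A : set T) : \bar rat :=
  if `[< finite_set A >] then (#|` fset_set A|%:R)%:E else +oo%E.

Section Reidemeister.
Variables (G1 G2 : groupType) (f g : {multiplicative G1 -> G2}).

Definition reidemeister_rel (a b : G2) : Prop :=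
  exists c : G1, b = g c * a * (f c)^-1.

Definition reidemeister_classes : set (set G2) :=
  range (fun a => [set b | reidemeister_rel a b]).

Definition reidemeister : \bar rat := ecard reidemeister_classes.

End Reidemeister.

(* Main.v *)
Require Import Defs.
From HB Require Import structures.
From mathcomp Require Import all_boot all_order all_algebra.
From mathcomp Require Import finmap boolp classical_sets functions cardinality fsbigop.
From mathcomp Require Import constructive_ereal ereal.

Set Implicit Arguments.
Unset Strict Implicit.
Unset Printing Implicit Defensive.

Import Order.TTheory GRing.Theory Num.Theory.

Local Open Scope classical_set_scope.
Local Open Scope group_scope.

(** The group [Pi1] acts on [Pi2] by [c . a = psi c * a * (phi c)^-1]; the orbits
    are the Reidemeister classes of [(phi, psi)] and the stabilisers are
    coincidence groups.  Right multiplication by [a] identifies the classes of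
    [(tau_a phi', psi')] with the [Gamma1]-orbits inside the coset of [a]
    ([shift_classes]), so that the sum counts all [Gamma1]-orbits on [Pi2]
    ([ecard_suborbits]).  Since [Gamma1] has finite index, there are finitely many
    [Gamma1]-orbits exactly when there are finitely many [Pi1]-orbits
    ([finite_suborbits]).  When both numbers are finite the formula says that each
    [Pi1]-orbit splits into [Pi1 : Gamma1] orbits of [Gamma1], which holds as soon
    as [Pi1] acts freely ([ecard_suborbits_free]).

    A non-trivial stabiliser meets [Gamma1] in an element of infinite order,
    because [Pi1] is torsion free and [Gamma1] has finite index.  So everything
    rests on [finite_orbits_stabiliser]: if a polycyclic group acts on another one
    by [c . x = g c * x * (f c)^-1] with finitely many orbits, and has a series
    with at most as many infinite cyclic factors as one of the other group, then
    all stabilisers are periodic.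

    This is proved by counting in finite quotients.  Let [h1], [h2] be the numbers
    of infinite factors of two polycyclic series.  A quotient of exponent [m] of a
    polycyclic group with [h] infinite factors has at most [C * m ^ h] elements,
    and cosets of a subgroup that contains, besides the [m]-th powers, an element
    of infinite order number at most [C * m ^ (h - 1)] ([covered_expn],
    [covered_expn_elt]).  In the other direction, for a suitable [e] the [n]-th
    term [N n] of the lower exponent-2 central series of the subgroup of [e]-th
    powers has index at least a constant times [(2 ^ n) ^ h]
    ([spread_lower2]), although its quotient has exponent dividing [e * 2 ^ n].

    Now let [z] be an element of infinite order that stabilises [x].  The products
    [U n] of the orbit of [x] by [N n] decrease and are unions of orbits, so they
    are eventually constant, equal to some [U n0].  Thus each [U n] contains the whole coset [x * N n0], hence a fixed proportion of the cosets of
    [N n], about [(2 ^ n) ^ h2] of them.  But the cosets of [N n] in [U n] form one orbit,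
    with a stabiliser containing [z] and all [e * 2 ^ n]-th powers, so there are at most
    about [(2 ^ n) ^ (h1 - 1)] of them, which is absurd for large [n] when
    [h1 <= h2]. *)

(** * Powers, subgroups and commutators *)

Section Subgroups.
Variable G : groupType.
Implicit Types (x y z g t : G) (a b : int) (H K L X Y : set G).

Lemma expgzD x a b : expgz x (a + b) = expgz x a * expgz x b.
Proof.
have expgzS c : expgz x (c + 1) = expgz x c * x.
  case: c => [n|[|n]]; first by rewrite -PoszD addn1 /= expgSr.
    by rewrite /= mulVg.
  have -> : (Negz n.+1 + 1)%R = Negz n by rewrite !NegzE -addn1 PoszD opprD subrK.
  by rewrite /= [in RHS]expgS invgM mulgVK.
have expgzP c : expgz x (c - 1) = expgz x c * x^-1.
  by rewrite -[in RHS](subrK 1%R c) expgzS mulgK.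
elim/int_ind: b => [|n IHn|n IHn]; first by rewrite addr0 mulg1.
  by rewrite -addn1 PoszD addrA expgzS IHn -mulgA -expgzS.
by rewrite -addn1 PoszD opprD addrA expgzP IHn -mulgA -expgzP.
Qed.

Lemma expgzN x a : expgz x (- a) = (expgz x a)^-1.
Proof. by apply/esym/mulg1_eq; rewrite -expgzD subrr. Qed.

Lemma expgz_mulnl x (m : nat) a : expgz x (m%:Z * a) = expgz (x ^+ m) a.
Proof.
have pos (n : nat) : expgz x (m%:Z * n%:Z) = expgz (x ^+ m) n%:Z.
  by rewrite -PoszM /= expgnA.
by case: a => n; rewrite ?NegzE ?mulrN ?expgzN pos.
Qed.

(** Subgroups are handled as plain predicates, so that the members of a
    polycyclic series and all derived subgroups live in one ambient group. *)
Definition subgroup H :=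
  [/\ H 1, forall x y, H x -> H y -> H (x * y) & forall x, H x -> H x^-1].

Definition normalises K L := forall y x, K y -> L x -> L (y * x * y^-1).

Lemma subgroupX H x n : subgroup H -> H x -> H (x ^+ n).
Proof.
by move=> [H1 HM _] Hx; elim: n => // n IHn; rewrite expgS; apply: HM.
Qed.

Lemma subgroup_expgz H x a : subgroup H -> H x -> H (expgz x a).
Proof.
move=> sH Hx; have [_ _ HV] := sH.
by case: a => n /=; [|apply: HV]; apply: subgroupX.
Qed.

Lemma normalisesX K L x y n : subgroup K -> normalises K L ->
  K y -> L x -> L (y ^+ n * x * y ^- n).
Proof. by move=> sK nL Ky Lx; apply: nL => //; apply: subgroupX. Qed.

Definition generated X : set G :=
  [set x | forall H, subgroup H -> X `<=` H -> H x].

Lemma subgroup_generated X : subgroup (generated X).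
Proof.
split=> [H [] //|x y Xx Xy H sH XH|x Xx H sH XH]; have [_ HM HV] := sH.
  by apply: HM; [apply: Xx|apply: Xy].
by apply: HV; apply: Xx.
Qed.

Lemma sub_generated X : X `<=` generated X.
Proof. by move=> x Xx H _; apply. Qed.

Lemma generated_sub X H : subgroup H -> X `<=` H -> generated X `<=` H.
Proof. by move=> sH XH x; apply. Qed.

Lemma normalises_preim K H y : subgroup H -> subgroup [set x | H (y * x * y^-1)].
Proof.
move=> [H1 HM HV]; split=> [|x z Hx Hz|x Hx] /=; first by rewrite !gnorm.
  by have := HM _ _ Hx Hz; rewrite !gnorm.
by have := HV _ Hx; rewrite !gnorm.
Qed.

Lemma normalises_generated K X : normalises K X -> normalises K (generated X).
Proof.
move=> nX y x Ky Xx; have sX := subgroup_generated X.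
apply: (Xx _ (normalises_preim setT y sX)) => z Xz /=.
by apply: sub_generated; apply: nX.
Qed.

Definition comm x y := x * y * x^-1 * y^-1.

(** This rests on [comm (x * z) y = (x * comm z y * x^-1) * comm x y]: modulo a
    subgroup normalised by [K], commutators with [y] are multiplicative up to
    conjugation. *)
Lemma subgroup_centraliser K L y : subgroup K -> subgroup L -> normalises K L ->
  subgroup [set x | K x /\ L (comm x y)].
Proof.
move=> [K1 KM KV] [L1 LM LV] nL; rewrite /comm.
split=> [|x z [Kx Lx] [Kz Lz]|x [Kx Lx]] /=; split.
- by [].
- by rewrite !gnorm.
- exact: KM.
- by have := LM _ _ (nL _ _ Kx Lz) Lx; rewrite !gnorm.
- exact: KV.
- by have := nL _ _ (KV _ Kx) (LV _ Lx); rewrite !gnorm.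
Qed.

Lemma comm_sym L x y : subgroup L -> L (comm x y) -> L (comm y x).
Proof. by move=> [_ _ LV] /LV; rewrite /comm !gnorm. Qed.

Lemma comm_sqrl x y : comm (x * x) y = comm x (comm x y) * (comm x y * comm x y).
Proof. by rewrite /comm !gnorm. Qed.

(** * The subgroup of powers and the lower exponent-2 central series *)

Definition powers e H : set G := generated [set x ^+ e | x in H].

(** The exponent-2 analogue of the lower central series: the quotient by the
    [n]-th term has exponent dividing [2 ^ n]. *)
Fixpoint lower2 H n : set G :=
  if n is n'.+1 then
    generated ([set comm x y | x in lower2 H n' & y in H] `|`
               [set x * x | x in lower2 H n'])
  else H.

End Subgroups.

Section LowerSeries.
Variable G : groupType.
Implicit Types (x y z g t : G) (a b : int) (H K L X Y : set G) (n m : nat).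

Lemma subgroup_lower2 H n : subgroup H -> subgroup (lower2 H n).
Proof. by case: n => //= n _; apply: subgroup_generated. Qed.

Lemma comm_lower2 H n x y : lower2 H n x -> H y -> lower2 H n.+1 (comm x y).
Proof. by move=> Hx Hy; apply: sub_generated; left; exists x => //; exists y. Qed.

Lemma sqr_lower2 H n x : lower2 H n x -> lower2 H n.+1 (x * x).
Proof. by move=> Hx; apply: sub_generated; right; exists x. Qed.

Lemma normalises_lower2 K H n : normalises K H -> normalises K (lower2 H n).
Proof.
move=> nH; elim: n => //= n IHn; apply: normalises_generated.
move=> y _ Ky [[a Ha [h Hh <-]]|[a Ha <-]]; [left|right].
  exists (y * a * y^-1); first exact: IHn.
  by exists (y * h * y^-1); [exact: nH|rewrite /comm !gnorm].
by exists (y * a * y^-1); [exact: IHn|rewrite !gnorm].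
Qed.

Global Arguments normalises_lower2 {K H} n _ [_ _].

Lemma normalises_self H : subgroup H -> normalises H H.
Proof. by move=> [_ HM HV] y x Hy Hx; exact: HM (HM _ _ Hy Hx) (HV _ Hy). Qed.

Lemma lower2S_sub H n : subgroup H -> lower2 H n.+1 `<=` lower2 H n.
Proof.
move=> sH; have [L1 LM LV] := subgroup_lower2 n sH.
apply: generated_sub; first exact: subgroup_lower2.
move=> _ [[a Ha [h Hh <-]]|[a Ha <-]]; last exact: LM.
have := LM _ _ Ha (normalises_lower2 n (normalises_self sH) Hh (LV _ Ha)).
by rewrite /comm !mulgA.
Qed.

Lemma lower2_anti H n m : subgroup H -> (n <= m)%N -> lower2 H m `<=` lower2 H n.
Proof.
move=> sH /subnK <-; elim: (m - n)%N => [|k IHk]; first by rewrite add0n.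
by rewrite addSn; apply: subset_trans IHk; apply: lower2S_sub.
Qed.

Lemma lower2_sub H n : subgroup H -> lower2 H n `<=` H.
Proof. by move=> sH; apply: (@lower2_anti H 0). Qed.

Lemma lower2_mono H K n : H `<=` K -> lower2 H n `<=` lower2 K n.
Proof.
move=> HK; elim: n => //= n IHn; apply: generated_sub => [|x Hx].
  exact: subgroup_generated.
apply: sub_generated; case: Hx => [[a Ha [h Hh <-]]|[a Ha <-]]; [left|right].
  by exists a; [apply: (IHn)|exists h => //; apply: HK].
by exists a => //; apply: (IHn).
Qed.

Lemma expg_lower2 H n x : H x -> lower2 H n (x ^+ (2 ^ n)%N).
Proof.
move=> Hx; elim: n => // n IHn; rewrite expnSr expgnA expg2; exact: sqr_lower2.
Qed.

Lemma coset_mul K L u v x y : subgroup K -> subgroup L -> normalises K L ->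
  K v -> L (u^-1 * x) -> L (v^-1 * y) -> L ((u * v)^-1 * (x * y)).
Proof.
move=> [_ _ KV] [_ LM _] nL Kv Lx /(LM _ _ (nL _ _ (KV _ Kv) Lx)).
by rewrite !gnorm.
Qed.

Lemma coset_inv K L u x : subgroup L -> normalises K L ->
  K u -> L (u^-1 * x) -> L (u * x^-1).
Proof. by move=> [_ _ LV] nL Ku /LV /(nL _ _ Ku); rewrite !gnorm. Qed.

Lemma coset_expgz K L u x b : subgroup K -> subgroup L -> normalises K L ->
  K u -> L (u^-1 * x) -> L ((expgz u b)^-1 * expgz x b).
Proof.
move=> sK sL nL Ku Lx; have [L1 _ _] := sL.
have Ln n : L (u ^- n * x ^+ n).
  elim: n => [|n IHn]; first by rewrite !expg0 !gnorm.
  by rewrite !expgS; apply: (@coset_mul K) => //; apply: subgroupX.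
case: b => n /=; first exact: Ln.
by rewrite invgK; apply: (@coset_inv K) => //; apply: subgroupX.
Qed.

Global Arguments coset_expgz {K L u x} b.

(** An element [u] of [H] acts by conjugation on the quotient of the [n]-th term
    by the [n.+2]-nd through [x |-> comm u x * x], where [comm u x] lies in the
    [n.+1]-st term, which is central modulo the [n.+2]-nd and has exponent 2
    there.  Two such maps commute and each has trivial square; hence the
    commutators and squares that generate the first term act trivially. *)
Lemma comm_lower2_1 H n x y : subgroup H ->
  lower2 H n x -> lower2 H 1 y -> lower2 H n.+2 (comm y x).
Proof.
move=> sH; have sL m := subgroup_lower2 m sH.
have [L1 LM LV] := sL n.+2; have [_ HM HV] := sH.
have nL m := normalises_lower2 m (normalises_self sH).
have cL m u z : H u -> lower2 H m z -> lower2 H m.+1 (comm u z).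
  by move=> Hu Lz; exact: comm_sym (sL _) (comm_lower2 Lz Hu).
pose C := [set y | H y /\ forall x, lower2 H n x -> lower2 H n.+2 (comm y x)].
have sC : subgroup C.
  have cent z : lower2 H n z -> subgroup [set y | H y /\ lower2 H n.+2 (comm y z)].
    by move=> _; apply: subgroup_centraliser => //; apply: nL.
  split=> [|u v [Hu Cu] [Hv Cv]|u [Hu Cu]]; split.
  - by case: sH.
  - by move=> z /cent[[]].
  - exact: HM.
  - move=> z Lz; have [_ ZM _] := cent z Lz.
    by case: (ZM u v) => //; split=> //; [apply: Cu|apply: Cv].
  - exact: HV.
  - by move=> z Lz; have [_ _ ZV] := cent z Lz; case: (ZV u) => //; split=> //; apply: Cu.
move=> Lx Ly; suff /generated_sub : [set comm x y | x in H & y in H] `|`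
    [set x * x | x in H] `<=` C by move=> /(_ sC y Ly)[_]; apply.
move=> _ [[u Hu [v Hv <-]]|[u Hu <-]]; split.
- by apply: (HM); [apply: (HM); [exact: HM|exact: HV]|exact: HV].
- move=> b Lb.
  pose w := v * u; pose z := w^-1 * b * w.
  have Lz : lower2 H n z.
    by rewrite /z -{2}[w]invgK; apply: (nL) => //; apply: (HV); apply: HM.
  (* [b] is the conjugate of [z] by [v * u], so that [comm (comm u v) b]
     compares the actions of [u * v] and of [v * u] on [z]. *)
  have -> : comm (comm u v) b =
      comm u (comm v z) * comm (comm v z) (comm u z) * (comm v (comm u z))^-1.
    by rewrite /z /w /comm !gnorm.
  apply: (LM); last by apply: LV; apply: (cL) => //; apply: (cL).
  apply: (LM); first by apply: (cL) => //; apply: (cL).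
  apply: comm_lower2; first exact: (cL).
  exact: lower2_sub (cL _ _ _ Hu Lz).
- exact: HM.
- move=> b Lb; rewrite comm_sqrl; apply: (LM); first by apply: (cL) => //; exact: (cL).
  by apply: sqr_lower2; exact: (cL).
Qed.

(** If conjugation by [t] is trivial on the first factor of the series, it is
    trivial on all of them, because each term is generated by commutators with
    [H] and squares of the previous one, and both are determined modulo the next
    term by classes in earlier factors. *)
Lemma comm_lower2_act K H n t x : subgroup K -> subgroup H ->
  H `<=` K -> normalises K H -> K t ->
  (forall y, H y -> lower2 H 1 (comm t y)) ->
  lower2 H n x -> lower2 H n.+1 (comm t x).
Proof.
move=> sK sH HK nH Kt t1; elim: n x => [|n IHn] x; first exact: t1.
have sL m := subgroup_lower2 m sH; have [L1 LM LV] := sL n.+2.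
have nL m := normalises_lower2 m (normalises_self sH).
have nLK m := normalises_lower2 m nH.
have [_ HM HV] := sH.
have cL m u z : H u -> lower2 H m z -> lower2 H m.+1 (comm u z).
  by move=> Hu Lz; exact: comm_sym (sL _) (comm_lower2 Lz Hu).
pose C := [set x | K x /\ lower2 H n.+2 (comm x t)].
have sC : subgroup C by apply: subgroup_centraliser => //; apply: nLK.
have sLH m : lower2 H m `<=` H by apply: lower2_sub.
move=> Lx; suff XC : [set comm x y | x in lower2 H n & y in H] `|`
    [set x * x | x in lower2 H n] `<=` C.
  by have [_ /(comm_sym (sL _))] := generated_sub sC XC Lx.
move=> _ [[u Lu [v Hv <-]]|[u Lu <-]]; split.
- by apply: HK; apply: (sLH n.+1); apply: comm_lower2.
- apply: (comm_sym (sL _)); set c := comm t u; set d := comm t v.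
  have Lc : lower2 H n.+1 c by apply: (IHn).
  have Ld : lower2 H 1 d by apply: (t1).
  have Hd : H d by apply: sLH Ld.
  have Luv : lower2 H n.+1 (comm u v) by apply: comm_lower2.
  have Hc : H c by apply: sLH Lc.
  (* [t] maps [u] to [c * u] and [v] to [d * v] *)
  have -> : comm t (comm u v) =
     comm c (comm u (d * v)) * comm u d * comm d (comm u v) *
     (comm u v * comm c (d * v) * (comm u v)^-1).
    by rewrite /c /d /comm !gnorm.
  apply: (LM); first apply: (LM); first apply: LM.
  + by apply: comm_lower2 => //; apply: (sLH n.+1); apply: comm_lower2 => //; apply: HM.
  + by apply: (comm_sym (sL _)); apply: comm_lower2_1.
  + exact: (cL).
  + apply: nL; first exact: sLH Luv.
    by apply: comm_lower2 => //; apply: HM.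
- by apply: HK; apply: (HM); apply: sLH Lu.
- apply: (comm_sym (sL _)); set c := comm t u.
  have Lc : lower2 H n.+1 c by apply: (IHn).
  have -> : comm t (u * u) = (c * c) * comm c^-1 u by rewrite /c /comm !gnorm.
  apply: (LM); first exact: sqr_lower2.
  have [_ _ LV1] := sL n.+1.
  by apply: comm_lower2; [exact: LV1|exact: sLH Lu].
Qed.

(** Each squaring of [t] gains one step: [comm t y] is moved by [t] within its
    class, so that [comm (t * t) y] is congruent to the square of [comm t y]. *)
Lemma comm_lower2_pow2 K H n t y : subgroup K -> subgroup H ->
  H `<=` K -> normalises K H -> K t ->
  (forall y, H y -> lower2 H 1 (comm t y)) ->
  H y -> lower2 H n.+1 (comm (t ^+ (2 ^ n)%N) y).
Proof.
move=> sK sH HK nH Kt t1 Hy; have sL m := subgroup_lower2 m sH.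
elim: n => [|n IHn]; first exact: t1.
rewrite expnSr expgnA expg2 comm_sqrl; have [_ LM _] := sL n.+2.
apply: (LM); last exact: sqr_lower2 IHn.
set s := t ^+ _ in IHn *; set c := comm s y in IHn *.
have sC : subgroup [set x | K x /\ lower2 H n.+2 (comm x c)].
  by apply: subgroup_centraliser => //; apply: normalises_lower2.
suff /(subgroupX (2 ^ n) sC)[] : [set x | K x /\ lower2 H n.+2 (comm x c)] t by [].
by split=> //=; exact: comm_lower2_act sK sH HK nH Kt t1 IHn.
Qed.

End LowerSeries.

(** * Counting cosets *)

Section Cosets.
Variable G : groupType.
Implicit Types (x y z g t : G) (a b : int) (H K L B N X Y : set G) (n m c : nat).

(** Upper bounds for the number of left cosets of [B] met by [X] are expressed by
    covers and lower bounds by separated families, which requires neither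
    quotients nor finiteness. *)
Definition covered X B c := exists2 s : seq G, (size s <= c)%N &
  forall x, X x -> exists2 y, y \in s & B (y^-1 * x).

Definition spread X B (s : seq G) :=
  [/\ uniq s, forall x, x \in s -> X x &
      {in s &, forall x y, B (x^-1 * y) -> x = y}].

Lemma spread_leq X B c s : subgroup B -> covered X B c -> spread X B s ->
  (size s <= c)%N.
Proof.
move=> [B1 BM BV] [ys leys cov] [us sX sB]; apply: leq_trans leys.
have [|f fP] := @choice G G (fun x y => X x -> y \in ys /\ B (y^-1 * x)).
  move=> x; have [/cov[y yys By]|nX] := pselect (X x); last by exists 1.
  by exists y.
rewrite -(size_map f); apply: uniq_leq_size => [|_ /mapP[x /sX/fP[? _] ->]//].
rewrite map_inj_in_uniq // => x y xs ys' fxy; apply: sB => //.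
have [_ Bx] := fP _ (sX _ xs); have [_ By] := fP _ (sX _ ys').
by have := BM _ _ (BV _ Bx) By; rewrite fxy !gnorm.
Qed.

Lemma covered_pigeonhole X B c (u : nat -> G) : subgroup B -> covered X B c ->
  (forall i, X (u i)) -> exists i j, (i < j)%N /\ B ((u i)^-1 * u j).
Proof.
move=> sB cov uX; have [B1 _ BV] := sB; apply: contrapT => nij.
have uB i j : B ((u i)^-1 * u j) -> i = j.
  move=> Bij; case: (ltngtP i j) => // ltij; case: nij; first by exists i, j.
  by exists j, i; split=> //; have := BV _ Bij; rewrite !gnorm.
have /(spread_leq sB cov) : spread X B (map u (iota 0 c.+1)).
  split=> [|_ /mapP[i _ ->] //|_ _ /mapP[i _ ->] /mapP[j _ ->] /uB -> //].
  by rewrite map_inj_uniq ?iota_uniq // => i j uij; apply: uB; rewrite uij mulVg.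
by rewrite size_map size_iota ltnn.
Qed.

Definition cyclic_ext g K H :=
  [/\ subgroup K, H `<=` K, normalises K H, K g &
      forall x, K x -> exists a : int, H ((expgz g a)^-1 * x)].

(** Polycyclic series are read from the bottom, so that statements about [K] are
    proved by induction on the series; [h] counts its infinite factors. *)
Inductive poly_hirsch : nat -> set G -> Prop :=
| PolyHirsch1 : poly_hirsch 0 [set 1]
| PolyHirschFin h K H g k : poly_hirsch h H -> cyclic_ext g K H ->
    (0 < k)%N -> H (g ^+ k) -> poly_hirsch h K
| PolyHirschInf h K H g : poly_hirsch h H -> cyclic_ext g K H ->
    (forall a, H (expgz g a) -> a = 0%R) -> poly_hirsch h.+1 K.

Lemma subgroup_poly_hirsch h K : poly_hirsch h K -> subgroup K.
Proof.
case=> [|? ? ? ? ? _ []//|? ? ? ? _ []//].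
by split=> // [x y -> ->|x ->]; rewrite /= ?mulg1 ?invg1.
Qed.

Lemma int_euclid a m : (0 < m)%N ->
  exists2 r, (r < m)%N & exists b, a = (r%:Z + m%:Z * b)%R.
Proof.
move=> m0; have /normr_idP rE : (0 <= (a %% m)%Z)%R by rewrite modz_ge0 // -lt0n.
exists `|(a %% m)%Z|%N.
  by rewrite -ltz_nat abszE rE ltz_pmod.
exists (a %/ m)%Z; rewrite abszE rE mulrC addrC; exact: divz_eq.
Qed.

Section CyclicExtension.
Variables (g : G) (K H : set G).
Hypotheses (sH : subgroup H) (extK : cyclic_ext g K H).

Lemma cyclic_ext_expn x k : K x ->
  exists a : int, H ((expgz (g ^+ k) a)^-1 * x ^+ k).
Proof.
have [sK _ nH Kg genK] := extK => /[dup] Kx /genK[a Ha].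
exists a; rewrite -expgz_mulnl.
have -> : expgz g (k%:Z * a) = expgz (expgz g a) k.
  elim: k => [|n IHn]; first by rewrite mul0r.
  by rewrite /= expgS intS mulrDl mul1r expgzD IHn.
exact: (coset_expgz k%:Z sK sH nH (subgroup_expgz a sK Kg) Ha).
Qed.

(** The three bounds that follow write an element of [K] as [g ^+ r * w * u] with
    [w] in [H] and [u] in [B]; they differ in how [H] or [B] absorbs the
    remaining power of [g]. *)
Lemma covered_ext B m c :
  (forall x, K x -> exists r w, [/\ (r < m)%N, H w & B (w^-1 * (g ^- r * x))]) ->
  subgroup B -> covered H B c -> covered K B (m * c).
Proof.
move=> Kx [_ BM _] [s les cov].
exists [seq g ^+ r * y | r <- iota 0 m, y <- s].
  by rewrite size_allpairs size_iota leq_mul2l les orbT.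
move=> x /Kx[r [w [ltrm Hw Bu]]]; have [y ys By] := cov _ Hw.
exists (g ^+ r * y); first by apply: allpairs_f => //; rewrite mem_iota.
by have := BM _ _ By Bu; rewrite !gnorm.
Qed.

Lemma covered_ext_fin B k c : subgroup B -> (0 < k)%N -> H (g ^+ k) ->
  covered H B c -> covered K B (k * c).
Proof.
move=> sB k0 Hgk; apply: covered_ext => //.
have [B1 _ _] := sB; have [_ HM _] := sH; have [_ _ _ _ genK] := extK.
move=> x /genK[a]; have [r ltrk [b ->]] := int_euclid a k0 => Ha.
exists r, (g ^- r * x); split=> //; last by rewrite mulVg.
have := HM _ _ (subgroup_expgz b sH Hgk) Ha.
by rewrite expgzD expgz_mulnl !gnorm.
Qed.

Lemma covered_ext_expn B N m c : subgroup B -> subgroup N -> normalises K N ->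
  N `<=` B -> (0 < m)%N -> N (g ^+ m) -> covered H B c -> covered K B (m * c).
Proof.
move=> sB sN nN NB m0 Ngm; apply: covered_ext => //.
have [[_ _ KV] HK _ _ genK] := extK.
move=> x /genK[a]; have [r ltrm [b ->]] := int_euclid a m0.
set w := _ * x => Hw; exists r, w; split=> //; apply: NB.
have := nN _ _ (KV _ (HK _ Hw)) (subgroup_expgz b sN Ngm).
by rewrite /w expgzD expgz_mulnl !gnorm.
Qed.

(** An element [z] of [B] that lies over [g ^+ m] makes [m] representatives
    enough, whatever the size of [K / H]. *)
Lemma covered_ext_elt B z m c : subgroup B -> B z -> (0 < m)%N ->
  H (g ^- m * z) -> covered H B c -> covered K B (m * c).
Proof.
move=> sB Bz m0 Hz; apply: covered_ext => //.
have [_ HM HV] := sH; have [sK HK nH Kg genK] := extK.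
move=> x /genK[a]; have [r ltrm [b ->]] := int_euclid a m0 => Hx.
exists r, (g ^- r * x * (expgz z b)^-1); split=> //; last first.
  by rewrite !gnorm; apply: subgroup_expgz.
have Kgm : K (g ^+ m) by apply: subgroupX.
have Kv := subgroup_expgz b sK Kgm.
have := HM _ _ (nH _ _ Kv Hx) (coset_inv sH nH Kv (coset_expgz b sK sH nH Kgm Hz)).
by rewrite expgzD expgz_mulnl !gnorm.
Qed.

Lemma cyclic_ext_fin x k : H (g ^+ k) -> K x -> H (x ^+ k).
Proof.
move=> Hgk Kx; have [_ HM _] := sH; have [a Ha] := cyclic_ext_expn k Kx.
by have := HM _ _ (subgroup_expgz a sH Hgk) Ha; rewrite mulVKg.
Qed.

End CyclicExtension.

(** A quotient of exponent [m] of a polycyclic group: each infinite cyclic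
    factor contributes at most [m], each finite one a constant. *)
Lemma covered_expn h K : poly_hirsch h K -> exists C, forall m N,
  (0 < m)%N -> subgroup N -> normalises K N -> (forall x, K x -> N (x ^+ m)) ->
  covered K N (C * m ^ h).
Proof.
elim=> {h K} [|h K H g k pH [C IH] extK k0 Hgk|h K H g pH [C IH] extK _].
- exists 1%N => m N _ [N1 _ _] _ _; exists [:: 1]; first by rewrite mul1n.
  by move=> x ->; exists 1; rewrite ?inE ?gnorm.
- have sH := subgroup_poly_hirsch pH; have [sK HK _ _ _] := extK.
  exists (k * C)%N => m N m0 sN nN Nm; rewrite -mulnA.
  apply: (covered_ext_fin sH extK) => //; apply: IH => // [y x /HK|x /HK].
    exact: nN.
  exact: Nm.
- have sH := subgroup_poly_hirsch pH; have [sK HK _ Kg _] := extK.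
  exists C => m N m0 sN nN Nm; rewrite expnS mulnCA.
  apply: (covered_ext_expn extK sN sN) => //; first exact: Nm.
  by apply: IH => // [y x /HK|x /HK]; [exact: nN|exact: Nm].
Qed.

(** Some power of [z] generates, up to finite index, one of the infinite cyclic
    factors.  Since [z] lies in [B], this factor contributes a constant instead of
    [m]. *)
Lemma covered_expn_elt h K z : poly_hirsch h K -> K z ->
  (forall n, (0 < n)%N -> z ^+ n <> 1) ->
  (0 < h)%N /\ exists C, forall m N B,
    (0 < m)%N -> subgroup N -> normalises K N -> (forall x, K x -> N (x ^+ m)) ->
    subgroup B -> N `<=` B -> B z -> covered K B (C * m ^ h.-1).
Proof.
move=> pK; elim: pK z => {h K} [|h K H g k pH IH extK k0 Hgk|h K H g pH IH extK _].
- by move=> z -> /(_ 1%N isT); rewrite expg1.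
- move=> z Kz zinf; have sH := subgroup_poly_hirsch pH.
  have [sK HK _ Kg genK] := extK.
  have Hzk : H (z ^+ k).
    exact: (cyclic_ext_fin sH extK).
  have [|h0 [C hC]] := IH _ Hzk.
    by move=> n n0; rewrite -expgnA; apply: zinf; rewrite muln_gt0 k0.
  split=> //; exists (k * C)%N => m N B m0 sN nN Nm sB NB Bz; rewrite -mulnA.
  apply: (covered_ext_fin sH extK) => //; apply: hC NB _ => //.
  + by move=> y x /HK; apply: nN.
  + by move=> x /HK; apply: Nm.
  + exact: subgroupX.
- move=> z Kz zinf; split=> //=; have sH := subgroup_poly_hirsch pH.
  have [sK HK nH Kg genK] := extK.
  have [C0 hC0] := covered_expn pH.
  have elt m0 z' : (0 < m0)%N -> H (g ^- m0 * z') ->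
     exists C, forall m N B,
    (0 < m)%N -> subgroup N -> normalises K N -> (forall x, K x -> N (x ^+ m)) ->
    subgroup B -> N `<=` B -> B z' -> covered K B (C * m ^ h).
    move=> m0_gt0 Hz'; exists (m0 * C0)%N => m N B m_gt0 sN nN Nm sB NB Bz.
    rewrite -mulnA; apply: (covered_ext_elt sH extK sB Bz) => //.
    have [|s les cov] := hC0 m N m_gt0 sN _ (fun x Hx => Nm _ (HK _ Hx)).
      by move=> y x /HK; apply: nN.
    by exists s => // x /cov[y ys /NB]; exists y.
  have [[[|l]|l] Hz] := genK _ Kz.
  + have Hz0 : H z by move: Hz; rewrite /= invg1 mul1g.
    have [h0 [C hC]] := IH _ Hz0 zinf.
    exists C => m N B m0 sN nN Nm sB NB Bz.
    rewrite -(prednK h0) expnS mulnCA.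
    apply: (covered_ext_expn extK sB sN nN) => //; first exact: Nm.
    apply: hC NB _ => //; first by move=> y x /HK; apply: nN.
    by move=> x /HK; apply: Nm.
  + exact: elt Hz.
  + have [|C hC] := elt l.+1 z^-1 isT; last first.
      exists C => m N B m0 sN nN Nm sB NB Bz; apply: hC NB _ => //.
      by have [_ _ BV] := sB; apply: BV.
    apply: (coset_inv sH nH) => //.
    by have [_ _ KV] := sK; apply: KV; apply: subgroupX.
Qed.

End Cosets.

(** * Growth of the quotients by the exponent-2 series *)

Section Growth.
Variable G : groupType.
Implicit Types (x y z g t : G) (a b : int) (H K L B N X Y : set G) (n m c e : nat).

Lemma powers_sub H K e f : (forall x, K x -> H (x ^+ f)) ->
  powers (f * e) K `<=` powers e H.
Proof.
move=> KH; apply: generated_sub; first exact: subgroup_generated.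
move=> _ [x /KH Hx <-]; apply: sub_generated; exists (x ^+ f) => //.
by rewrite expgnA.
Qed.

Lemma normalises_powers K H e : normalises K H -> normalises K (powers e H).
Proof.
move=> nH; apply: normalises_generated => y _ Ky [x Hx <-].
exists (y * x * y^-1); first exact: nH.
elim: e => [|n IHn]; first by rewrite !expg0 !gnorm.
by rewrite !expgS IHn !gnorm.
Qed.

Lemma spread_sub H K B B' s : H `<=` K -> B' `<=` B ->
  spread H B s -> spread K B' s.
Proof.
move=> HK BB [us sH sB]; split=> // [x /sH /HK //|x y xs ys /BB]; exact: sB.
Qed.

Definition prod_cycle H t : set G :=
  [set x | exists y a, H y /\ x = y * expgz t a].

Lemma subgroup_prod_cycle K H t : subgroup K -> subgroup H ->
  normalises K H -> K t -> subgroup (prod_cycle H t).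
Proof.
move=> sK [H1 HM HV] nH Kt; have nHt a y := nH _ y (subgroup_expgz a sK Kt).
split=> [|_ _ [y [a [Hy ->]]] [z [b [Hz ->]]]|_ [y [a [Hy ->]]]].
- by exists 1, 0%R; rewrite mul1g.
- exists (y * (expgz t a * z * (expgz t a)^-1)), (a + b)%R; split.
    by apply: (HM) => //; apply: nHt.
  by rewrite expgzD !gnorm.
- exists (expgz t (- a) * y^-1 * (expgz t (- a))^-1), (- a)%R; split.
    by apply: nHt; apply: HV.
  by rewrite !expgzN !gnorm.
Qed.

Lemma sub_prod_cycle H t : H `<=` prod_cycle H t.
Proof. by move=> x Hx; exists x, 0%R; rewrite mulg1. Qed.

(** Modulo the [n.+1]-st term of the series of [H], the element [t ^+ (2 ^ n)]
    commutes with [H], and [t] commutes with the [n]-th term.  So commutators of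
    products are trivial modulo that term, and the square of a product is the
    product of the squares. *)
Lemma lower2_prod_cycle K H t n : subgroup K -> subgroup H ->
  H `<=` K -> normalises K H -> K t ->
  (forall y, H y -> lower2 H 1 (comm t y)) ->
  lower2 (prod_cycle H t) n `<=` prod_cycle (lower2 H n) (t ^+ (2 ^ n)%N).
Proof.
move=> sK sH HK nH Kt t1; have sL m := subgroup_lower2 m sH.
have nLK m := normalises_lower2 m nH.
have [_ KM KV] := sK.
elim: n => [|n IHn]; first by [].
set L := lower2 H n.+1.
apply: generated_sub.
  exact: subgroup_prod_cycle sK (sL n.+1) (nLK n.+1) (subgroupX _ sK Kt).
set s := t ^+ (2 ^ n)%N in IHn *; have Ks : K s by apply: subgroupX.
have cen y : subgroup [set x | K x /\ L (comm x y)].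
  by apply: subgroup_centraliser => //; [exact: sL|exact: nLK].
have cenX u y a : K u -> L (comm u y) -> L (comm (expgz u a) y).
  move=> Ku Lu; suff [] : [set x | K x /\ L (comm x y)] (expgz u a) by [].
  by apply: subgroup_expgz.
have cenM u v y : K u -> K v -> L (comm u y) -> L (comm v y) -> L (comm (u * v) y).
  by move=> Ku Kv Lu Lv; have [_ CM _] := cen y; have [] := CM u v.
have Lsym u v : L (comm u v) -> L (comm v u) by exact: comm_sym (sL n.+1).
have LHK m : lower2 H m `<=` K by apply: subset_trans HK; apply: lower2_sub.
have tx x a : lower2 H n x -> L (comm (expgz t a) x).
  by move=> Lx; apply: cenX => //; exact: comm_lower2_act sK sH HK nH Kt t1 Lx.
have sx x a : lower2 H n x -> L (comm (expgz s a) x).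
  by move=> Lx; rewrite -expgz_mulnl; apply: tx.
have sy y a : H y -> L (comm (expgz s a) y).
  by move=> Hy; apply: cenX => //; exact: (comm_lower2_pow2 sK).
move=> _ [[_ /IHn[x [a [Lx ->]]] [_ [y [b [Hy ->]]] <-]]
         |[_ /IHn[x [a [Lx ->]]] <-]].
  apply: sub_prod_cycle; set r := expgz t b.
  have Ky := HK _ Hy; have Kx := LHK _ _ Lx.
  have Ksa := subgroup_expgz a sK Ks; have Kr := subgroup_expgz b sK Kt.
  apply: (cenM) => //; apply: (Lsym); apply: (cenM) => //; apply: (Lsym).
  - exact: comm_lower2.
  - by apply: (Lsym); apply: tx.
  - exact: sy.
  - have -> : comm (expgz s a) r = 1.
      by rewrite /comm /r /s -expgz_mulnl -expgzD addrC expgzD !gnorm.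
    by have [] := sL n.+1.
exists (x * x * comm x^-1 (expgz s a)), a; split.
  have [_ LM _] := sL n.+1; apply: LM; first exact: sqr_lower2.
  have Kx := LHK _ _ Lx; have [_ _ CV] := cen (expgz s a).
  by have [] := CV x; first by split=> //; apply: (Lsym); apply: sx.
have -> : t ^+ (2 ^ n.+1)%N = s ^+ 2 by rewrite expnSr expgnA.
rewrite -expgz_mulnl (_ : (2%:Z * a = a + a)%R); last by rewrite (intS 1) mulrDl mul1r.
by rewrite expgzD /comm !gnorm.
Qed.

(** Every class of the finite quotient [H / L] is fixed by some power of [g], by
    the pigeonhole principle; the product of these exponents over a system of
    representatives works for all of them. *)
Lemma act_trivially K H L g q : subgroup K -> subgroup H -> subgroup L -> L `<=` H ->
  normalises K H -> normalises K L -> H `<=` K -> K g -> covered H L q ->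
  exists2 k, (0 < k)%N & forall y, H y -> L (comm (g ^+ k) y).
Proof.
move=> sK sH sL LH nH nL HK Kg cov; have [s _ covs] := cov.
have cen y : subgroup [set x | K x /\ L (comm x y)] by apply: subgroup_centraliser.
have one y : H y -> exists2 k, (0 < k)%N & L (comm (g ^+ k) y).
  move=> Hy; have Hu i : H (g ^+ i * y * g ^- i) by apply: normalisesX Kg Hy.
  have [i [j [/subnKC <-]]] := covered_pigeonhole sL cov Hu.
  rewrite addSnnS; set d := (j - i.+1).+1 => Lij; exists d => //.
  have [_ _ KV] := sK; have Kgi := KV _ (subgroupX i sK Kg).
  have := nL _ _ (HK _ Hy) (nL _ _ Kgi Lij).
  by rewrite /comm !expgnDr !gnorm.
have [k k0 kP] : exists2 k, (0 < k)%N &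
    forall y, y \in s -> H y -> L (comm (g ^+ k) y).
  elim: s {covs} => [|y s [k k0 IHs]]; first by exists 1%N.
  have [/one[l l0 Ll]|nHy] := pselect (H y); last first.
    by exists k => // z; rewrite inE => /predU1P[->|/IHs].
  exists (k * l)%N => [|z]; first by rewrite muln_gt0 k0.
  rewrite inE => /predU1P[-> _|/IHs Lz /Lz {}Lz].
    rewrite mulnC expgnA; have /(subgroupX k (cen y))[] // :
      [set x | K x /\ L (comm x y)] (g ^+ l) by split=> //; apply: subgroupX.
  rewrite expgnA; have /(subgroupX l (cen z))[] // :
    [set x | K x /\ L (comm x z)] (g ^+ k) by split=> //; apply: subgroupX.
exists k => // x Hx; have [y ys Ly] := covs _ Hx.
have [_ _ KV] := sK; have Kgk := subgroupX k sK Kg.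
have Hyx := LH _ Ly; have [_ HM HV] := sH; have [_ LM LV] := sL.
have Hy : H y by have := HM _ _ Hx (HV _ Hyx); rewrite !gnorm.
have [_ CM _] := cen (g ^+ k).
have [] := CM y (y^-1 * x); last by rewrite mulVKg => _ /(comm_sym sL).
  by split; [exact: HK|apply: (comm_sym sL); exact: kP].
split; first exact: HK.
by have := LM _ _ Ly (nL _ _ Kgk (LV _ Ly)); rewrite /comm !mulgA.
Qed.

(** A [k]-th power in [K] is [s * w] with [s] a power of [g ^+ k] and [w] in [H].
    As [s] and [w] commute modulo [L], the [e]-th power of their product is
    [s ^+ e * w ^+ e] up to an element of [L]. *)
Lemma powers_prod_cycle K H L g k e : subgroup H -> cyclic_ext g K H ->
  subgroup L -> L `<=` powers e H -> normalises K L ->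
  (forall y, H y -> L (comm (g ^+ k) y)) ->
  powers (k * e) K `<=` prod_cycle (powers e H) (g ^+ k).
Proof.
move=> sH extK sL LP nL tL; have [sK HK nH Kg _] := extK.
have sP : subgroup (powers e H) by apply: subgroup_generated.
have nP : normalises K (powers e H) by exact: normalises_powers.
set t := g ^+ k in tL *; have Kt : K t by apply: subgroupX.
have [L1 LM LV] := sL; have [_ KM KV] := sK; have [_ HM HV] := sH.
apply: generated_sub; first exact: subgroup_prod_cycle sK sP nP Kt.
move=> _ [x Kx <-]; have [a] := cyclic_ext_expn sH extK k Kx.
rewrite -/t; set s := expgz t a; set w := _ * _ => Hw.
have -> : x ^+ (k * e)%N = (s * w) ^+ e by rewrite expgnA /w mulVKg.
have Ks : K s by apply: subgroup_expgz.
have Lsw i : L ((s ^+ i * w ^+ i)^-1 * (s * w) ^+ i).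
  elim: i => [|i IHi]; first by rewrite !expg0 !gnorm.
  have Ksw : K (s * w) by apply: KM => //; apply: HK.
  have Lcomm : L (comm (w ^- i) s^-1).
    apply: (comm_sym sL).
    have sC : subgroup [set x | K x /\ L (comm x (w ^- i))].
      exact: subgroup_centraliser.
    have : [set x | K x /\ L (comm x (w ^- i))] s^-1.
      rewrite /s -expgzN; apply: subgroup_expgz => //; split=> //; apply: tL.
      by apply: HV; apply: subgroupX.
    by case.
  have L1' : L ((s * w)^-1 * (s * w)) by rewrite mulVg.
  have := LM _ _ (nL _ _ (KV _ (HK _ Hw)) Lcomm) (coset_mul sK sL nL Ksw IHi L1').
  by rewrite [s ^+ i.+1]expgSr [w ^+ i.+1]expgSr [(s * w) ^+ i.+1]expgSr /comm !gnorm.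
have [_ PM PV] := sP.
pose r := (s ^+ e * w ^+ e)^-1 * (s * w) ^+ e.
exists (s ^+ e * (w ^+ e * r) * s ^- e), (a * e%:Z)%R; split.
  apply: nP; first exact: subgroupX.
  by apply: PM; [apply: sub_generated; exists w|apply: LP; exact: Lsw].
have -> : expgz t (a * e%:Z) = s ^+ e.
  elim: (e) => [|n IHn]; first by rewrite mulr0.
  by rewrite expgS -IHn intS mulrDr mulr1 expgzD.
by rewrite /r !gnorm.
Qed.

(** Multiplying a separated family in [H] by the powers of [t] below [n] keeps it
    separated, since the classes of these powers modulo [<t ^+ n>] are distinct
    and [<t>] meets [H] trivially. *)
Lemma spread_prod_cycle K H B g t k n (s : seq G) : subgroup H ->
  cyclic_ext g K H -> (0 < k)%N -> t = g ^+ k ->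
  (forall a, H (expgz g a) -> a = 0%R) -> subgroup B -> B `<=` H ->
  spread H B s -> spread K (prod_cycle B (t ^+ n)) [seq t ^+ j * y | j <- iota 0 n, y <- s].
Proof.
move=> sH [sK HK nH Kg genK] k0 tE ginf sHB BH [us sHs sB].
have [H1 HM HV] := sH; have [_ KM KV] := sK.
have Kt : K t by rewrite tE; apply: subgroupX.
pose B' := prod_cycle B (t ^+ n).
have key i j y z : (i < n)%N -> (j < n)%N -> y \in s -> z \in s ->
    B' ((t ^+ i * y)^-1 * (t ^+ j * z)) -> i = j /\ y = z.
  move=> ltin ltjn ys zs [u [a [Bu E]]].
  set tau := expgz (t ^+ n) a in E.
  have Ktau : K tau by apply: subgroup_expgz => //; apply: subgroupX.
  (* the power of [g] between the two elements lies in [H], hence is trivial *)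
  have : H (t ^- i * t ^+ j * tau^-1).
    have -> : t ^- i * t ^+ j * tau^-1 = y * u * (tau * z^-1 * tau^-1).
      have -> : u = (t ^+ i * y)^-1 * (t ^+ j * z) * tau^-1 by rewrite E !gnorm.
      by rewrite !gnorm.
    apply: (HM); first by apply: (HM); [exact: sHs|exact: BH].
    by apply: (nH) => //; apply: (HV); exact: sHs.
  have -> : t ^- i * t ^+ j * tau^-1 = expgz g (k%:Z * (j%:Z - (i%:Z + n%:Z * a))).
    have ti : t ^+ i = expgz t i by [].
    have tj : t ^+ j = expgz t j by [].
    rewrite expgz_mulnl -tE /tau -expgz_mulnl ti tj -!expgzN -!expgzD.
    by congr (expgz t _); rewrite opprD addrCA addrA.
  move/ginf/eqP; rewrite mulf_eq0 eqz_nat eqn0Ngt k0 /= subr_eq0 => /eqP jE.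
  have jiE : i = j.
    have := congr1 (fun b => (b %% n)%Z) jE; rewrite /= addrC [(n%:Z * _)%R]mulrC modzMDl.
    by rewrite !modz_nat !modn_small // => -[].
  have a0 : tau = 1.
    move: jE; rewrite jiE -{1}[Posz j]addr0 => /addrI/esym/eqP.
    rewrite mulf_eq0 eqz_nat eqn0Ngt (leq_ltn_trans _ ltin) //= => /eqP a0.
    by rewrite /tau a0.
  split=> //; apply: sB => //; move: E; rewrite jiE a0 !gnorm => ->.
  done.
split.
- apply: allpairs_uniq => //; first exact: iota_uniq.
  move=> _ _ /allpairsP[[i y] /= [iI ys ->]] /allpairsP[[j z] /= [jI zs ->]] /= E.
  have [] := key i j y z _ _ ys zs; rewrite ?mem_iota in iI jI *=> //.
    by rewrite E mulVg; exists 1, 0%R; split; [case: sHB|rewrite mul1g].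
  by move=> -> ->.
- move=> _ /allpairsP[[i y] /= [iI ys ->]].
  by apply: KM; [exact: subgroupX|apply/HK/sHs].
- move=> _ _ /allpairsP[[i y] /= [iI ys ->]] /allpairsP[[j z] /= [jI zs ->]] Bq.
  by rewrite ?mem_iota in iI jI; have [//|//|-> -> //] := key i j y z _ _ ys zs Bq.
Qed.

(** The lower bound, by induction on the series.  A finite factor only changes
    [e].  For an infinite factor generated by [g], a power [t] of [g] acts
    trivially on the first factor of the series of [P = powers e H]; then the
    series of the finite index subgroup [P <t>] grows by one factor [2] per step
    more than the series of [P]. *)
Lemma spread_lower2 h K : poly_hirsch h K -> exists e c, (0 < e)%N /\ forall n,
  exists2 s, (2 ^ (n * h) <= c * size s)%N & spread K (lower2 (powers e K) n) s.
Proof.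
elim=> {h K} [|h K H g k pH [e [c [e0 IH]]] extK k0 Hgk
              |h K H g pH [e [c [e0 IH]]] extK ginf].
- exists 1%N, 1%N; split=> // n; exists [:: 1]; first by rewrite muln0.
  by split=> // [x|x y]; rewrite !inE => /eqP-> // /eqP->.
- have sH := subgroup_poly_hirsch pH; have [_ HK _ _ _] := extK.
  exists (k * e)%N, c; split=> [|n]; first by rewrite muln_gt0 k0.
  have [s les sprs] := IH n; exists s => //; apply: spread_sub HK _ sprs.
  apply: lower2_mono; apply: powers_sub => x; exact: (cyclic_ext_fin sH extK).
- have sH := subgroup_poly_hirsch pH; have [sK HK nH Kg genK] := extK.
  set P := powers e H; have sP : subgroup P by apply: subgroup_generated.
  have PH : P `<=` H.
    by apply: generated_sub => // _ [x Hx <-]; apply: subgroupX.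
  have nP : normalises K P by exact: normalises_powers.
  have nL n := normalises_lower2 n nP; have sL n := subgroup_lower2 n sP.
  have [C covC] := covered_expn pH.
  have covL : covered H (lower2 P 1) (C * (e * 2) ^ h).
    apply: covC => //; first by rewrite muln_gt0 e0.
      by move=> y x /HK; apply: nL.
    move=> x Hx; rewrite expgnA; apply: (expg_lower2 1).
    by apply: sub_generated; exists x.
  have LP : lower2 P 1 `<=` P by apply: lower2_sub.
  have LH := subset_trans LP PH.
  have [k k0 kL] := act_trivially sK sH (sL 1%N) LH nH (nL 1%N) HK Kg covL.
  exists (k * e)%N, c; split=> [|n]; first by rewrite muln_gt0 k0.
  have [s les sprs] := IH n.
  exists [seq (g ^+ k) ^+ j * y | j <- iota 0 (2 ^ n)%N, y <- s].
    by rewrite size_allpairs size_iota mulnS expnD mulnCA leq_mul2l les orbT.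
  have LnH : lower2 P n `<=` H by apply: subset_trans PH; apply: lower2_sub.
  apply: (@spread_sub K K _ _ _ _ _
    (spread_prod_cycle (2 ^ n) sH extK k0 erefl ginf (sL n) LnH sprs)) => //.
  have Kt : K (g ^+ k) by apply: subgroupX.
  have tP y (Py : P y) := kL y (PH y Py).
  have PK := subset_trans PH HK.
  move=> x Lx; apply: (lower2_prod_cycle sK sP PK nP Kt tP).
  by apply: lower2_mono Lx; apply: (powers_prod_cycle sH extK (sL 1%N)).
Qed.

End Growth.

(** * Polycyclic series and cosets *)

Section Series.
Variable G : groupType.
Implicit Types (H : groupClosed G) (x y g : G).

Lemma subgroup_groupClosed H : subgroup [set` H].
Proof.
by split=> [|x y Hx Hy|x Hx] /=; [exact: gpred1|exact: gpredM|rewrite gpredV].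
Qed.

Lemma coset_eq H x y : y^-1 * x \in H ->
  [set x * k | k in [set` H]] = [set y * k | k in [set` H]].
Proof.
have sub u v : v^-1 * u \in H ->
    [set u * k | k in [set` H]] `<=` [set v * k | k in [set` H]].
  move=> Huv _ [k /= Hk <-]; exists (v^-1 * u * k); first exact: gpredM.
  by rewrite !mulgA mulgV mul1g.
move=> Hyx; apply/seteqP; split; apply: sub => //.
by rewrite -gpredV invgM invgK.
Qed.

Lemma finite_cosetsP H (K : {pred G}) :
  finite_set (cosets_in H K) <-> exists c, covered [set` K] [set` H] c.
Proof.
split=> [/finite_seqP[s sE]|[c [s _ cov]]].
  exists (size s), (map (xget 1) s); first by rewrite size_map.
  move=> x Kx; set A := [set x * k | k in [set` H]].
  have As : A \in s.
    have : cosets_in H K A by exists x.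
    by rewrite sE.
  exists (xget 1 A); first exact: map_f.
  have : A (xget 1 A) by apply: (@xgetI _ _ _ x); exists 1; [exact: gpred1|rewrite mulg1].
  by case=> k /= Hk <-; rewrite invgM mulgVK gpredV.
apply: sub_finite_set (finite_image (fun y => [set y * k | k in [set` H]]) (finite_seq s)).
by move=> _ [x /cov[y ys Hyx] <-]; exists y => //; apply/esym/coset_eq.
Qed.

(** Both kinds of factors are recognised by counting cosets: finitely many force
    a positive power of the generator into the next term, and conversely. *)
Lemma poly_hirsch_series n (S : nat -> groupClosed G) : polycyclic_series n S ->
  poly_hirsch (num_infinite_factors n S) [set: G].
Proof.
move=> [S0 Sn Sstep].
pose b i : nat := `[< infinite_set (cosets_in (S i.+1) (S i)) >].
have -> : num_infinite_factors n S = (\sum_(0 <= i < n) b i)%N.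
  rewrite /num_infinite_factors big_mkord -sum1_card big_mkcond /=.
  by apply: eq_bigr => i _; rewrite inE /b; case: asboolP.
have -> : [set: G] = [set` S 0%N] by apply/seteqP; split=> x _ //=; rewrite S0.
suff main d : (d <= n)%N ->
    poly_hirsch (\sum_(n - d <= i < n) b i)%N [set` S (n - d)%N].
  by have := main n (leqnn n); rewrite subnn.
elim: d => [_|d IHd ltdn].
  rewrite subn0 big_geq // (_ : [set` S n] = [set 1]); first exact: PolyHirsch1.
  by apply/seteqP; split=> x /=; rewrite Sn => /eqP.
have iE : (n - d)%N = (n - d.+1).+1 by rewrite subnSK.
move: (n - d.+1)%N iE (leq_subr d n) (IHd (ltnW ltdn)) => i -> ltin pS.
rewrite big_ltn //; have [[subS nS] [g Sg genS]] := Sstep i ltin.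
have ext : cyclic_ext g [set` S i] [set` S i.+1].
  split=> //; first exact: subgroup_groupClosed.
  by move=> y x Sy Sx; apply: nS.
rewrite {1}/b; case: asboolP => [inf|/contrapT /finite_cosetsP[c cov]].
  rewrite add1n; apply: (PolyHirschInf pS ext) => a Sa.
  have [->//|[k k0 Sgk]] : a = 0%R \/ exists2 k, (0 < k)%N & g ^+ k \in S i.+1.
    case: a Sa => [[|k]|k] /= Sa; [by left|right; exists k.+1 => //..].
    by rewrite -gpredV.
  case: inf; apply/finite_cosetsP; exists (k * 1)%N.
  apply: (covered_ext_fin (subgroup_groupClosed _) ext) => //.
    exact: subgroup_groupClosed.
  by exists [:: 1] => // x Sx; exists 1; rewrite ?inE //= invg1 mul1g.
have gX j : [set` S i] (g ^+ j) by apply: gpredXn.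
have [j [l [ltjl Sjl]]] :=
  covered_pigeonhole (subgroup_groupClosed (S i.+1)) cov gX.
apply: PolyHirschFin pS ext (_ : 0 < l - j)%N _; first by rewrite subn_gt0.
by move: Sjl => /=; rewrite -{1}(subnKC (ltnW ltjl)) expgnDr mulKg.
Qed.

Lemma poly_hirsch_length : polycyclic G -> poly_hirsch (hirsch_length G) [set: G].
Proof.
move=> [n [S pS]]; rewrite /hirsch_length.
set A := [set h | _]; have [m [T [pT ->]]] : A (xget 0%N A).
  by apply: xgetPex; exists (num_infinite_factors n S), n, S.
exact: poly_hirsch_series.
Qed.

End Series.

(** * Finitely many twisted classes force periodic stabilisers *)

Section Multiplicative.
Variables (G1 G2 : groupType) (f : {multiplicative G1 -> G2}).

Lemma multiplicative1 : f 1 = 1.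
Proof. by apply: (mulgI (f 1)); rewrite mulg1 -gmulfM mulg1. Qed.

Lemma multiplicativeV x : f x^-1 = (f x)^-1.
Proof. by apply/esym/mulg1_eq; rewrite -gmulfM mulgV multiplicative1. Qed.

Lemma multiplicativeX x n : f (x ^+ n) = f x ^+ n.
Proof. by elim: n => [|n IHn]; rewrite ?multiplicative1 // !expgS gmulfM IHn. Qed.

End Multiplicative.

Section TwistedAction.
Variables (G1 G2 : groupType) (f g : {multiplicative G1 -> G2}).
Implicit Types (c d : G1) (x y : G2).

(** The action whose orbits are the Reidemeister classes and whose stabilisers
    are the coincidence groups. *)
Definition twist c y : G2 := g c * y * (f c)^-1.

Lemma twist1 y : twist 1 y = y.
Proof. by rewrite /twist !multiplicative1 invg1 mulg1 mul1g. Qed.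

Lemma twistM c d y : twist (c * d) y = twist c (twist d y).
Proof. by rewrite /twist !gmulfM invgM !mulgA. Qed.

Lemma twistK c y : twist c^-1 (twist c y) = y.
Proof. by rewrite -twistM mulVg twist1. Qed.

Lemma coset_twist (N : set G2) c x y : normalises setT N ->
  N (x^-1 * y) -> N ((twist c x)^-1 * twist c y).
Proof. by move=> nN /(nN (f c) _ I); rewrite /twist !gnorm. Qed.

Lemma stabiliser_twist (N : set G2) x : subgroup N -> normalises setT N ->
  subgroup [set c | N (x^-1 * twist c x)].
Proof.
move=> [N1 NM NV] nN; split=> [|c d Nc Nd|c Nc] /=.
- by rewrite twist1 mulVg.
- by have := NM _ _ Nc (coset_twist c nN Nd); rewrite twistM mulgA mulgK.
- by have := NV _ (coset_twist c^-1 nN Nc); rewrite twistK invgM invgK.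
Qed.

Lemma orbit_reps : finite_set (reidemeister_classes f g) ->
  exists s : seq G2, forall y, exists2 w, w \in s & exists c, y = twist c w.
Proof.
move=> /finite_seqP[s sE]; exists (map (xget 1) s) => y.
set A := [set b | reidemeister_rel f g y b].
have As : A \in s.
  have : reidemeister_classes f g A by exists y.
  by rewrite sE.
exists (xget 1 A); first exact: map_f.
have : A (xget 1 A) by apply: (@xgetI _ _ _ y); exists 1; rewrite -/(twist 1 y) twist1.
by move=> [c wE]; exists c^-1; rewrite wE -/(twist c y) twistK.
Qed.

(** Each of the finitely many orbits leaves the decreasing sequence at most
    once. *)
Lemma stationary_orbits (U : nat -> set G2) :
  finite_set (reidemeister_classes f g) ->
  (forall n c y, U n y -> U n (twist c y)) ->
  (forall n m, (n <= m)%N -> U m `<=` U n) ->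
  exists n0, forall n, U n0 `<=` U n.
Proof.
move=> /orbit_reps[s cov] Uinv anti.
have [n0 n0P] : exists n0, forall w, w \in s -> U n0 w -> forall n, U n w.
  elim: s {cov} => [|w s [n0 IHs]]; first by exists 0%N.
  have [Uw|] := pselect (forall n, U n w).
    by exists n0 => v; rewrite inE => /predU1P[->|/IHs].
  move=> /existsNP[n1 nUw]; exists (maxn n0 n1) => v.
  rewrite inE => /predU1P[->|/IHs vs] Uv; first last.
    by apply: vs; apply: anti Uv; apply: leq_maxl.
  by case: nUw; apply: anti Uv; apply: leq_maxr.
exists n0 => n y Uy; have [w ws [c yE]] := cov y.
rewrite yE; apply: (Uinv); apply: n0P => //.
by have := Uinv _ c^-1 _ Uy; rewrite yE twistK.
Qed.

(** The closure argument.  The orbit of [x] is, up to the subgroups [N n] of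
    the exponent-2 series, open: it fills a coset of [N n0] modulo every [N n],
    hence at least a constant proportion of the quotient by [N n], that is
    about [(2 ^ n) ^ h2] cosets.  If [z] has infinite order, the orbit meets at
    most about [(2 ^ n) ^ (h1 - 1)] of them. *)
Lemma finite_orbits_stabiliser h1 h2 x z :
  poly_hirsch h1 [set: G1] -> poly_hirsch h2 [set: G2] -> (h1 <= h2)%N ->
  finite_set (reidemeister_classes f g) -> twist z x = x ->
  exists2 n, (0 < n)%N & z ^+ n = 1.
Proof.
move=> pG1 pG2 leh fin zx; apply: contrapT => ntors.
have zinf n : (0 < n)%N -> z ^+ n <> 1 by move=> n0 zn; case: ntors; exists n.
have [e [c [e0 spr]]] := spread_lower2 pG2.
set P := powers e _ in spr.
have sP : subgroup P by apply: subgroup_generated.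
have nP : normalises setT P by apply: normalises_powers.
pose N n := lower2 P n; have sN n : subgroup (N n) by apply: subgroup_lower2.
have nN n : normalises setT (N n) by apply: normalises_lower2.
have expN n y : N n (y ^+ (e * 2 ^ n)).
  by rewrite expgnA; apply: expg_lower2; apply: sub_generated; exists y.
have expn0 n : (0 < e * 2 ^ n)%N by rewrite muln_gt0 e0 expn_gt0.
pose U n := [set y | exists d, N n ((twist d x)^-1 * y)].
have [n0 Un0] : exists n0, forall n, U n0 `<=` U n.
  apply: stationary_orbits => // [n d y [d' Ny]|n m lenm y [d Ny]].
    by exists (d * d'); rewrite twistM; apply: coset_twist.
  by exists d; apply: lower2_anti Ny.
have [C0 /(_ _ (N n0) (expn0 n0) (sN n0))[//|//|s0 les0 cov0]] := covered_expn pG2.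
have [h1_gt0 [C covC]] := covered_expn_elt pG1 I zinf.
have cov n : covered setT (N n) ((C0 * (e * 2 ^ n0) ^ h2) *
                                 (C * (e * 2 ^ n) ^ h1.-1)).
  have [_ NM NV] := sN n.
  pose B := [set d | N n (x^-1 * twist d x)].
  pose M := [set d | N n (f d) /\ N n (g d)].
  have [||||||s les covs] := covC _ M B (expn0 n).
  - split=> [|d d' [Nf Ng] [Nf' Ng']|d [Nf Ng]] /=.
    + by rewrite /M /= !multiplicative1; case: (sN n).
    + by rewrite /M /= !gmulfM; split; apply: NM.
    + by rewrite /M /= !multiplicativeV; split; apply: NV.
  - by move=> d d' _ [Nf Ng]; rewrite /M /= !gmulfM !multiplicativeV; split; apply: nN.
  - by move=> d _; rewrite /M /= !multiplicativeX.
  - exact: stabiliser_twist.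
  - move=> d [Nf Ng]; rewrite /B /twist /= !mulgA; apply: NM; last exact: NV.
    by have := nN n x^-1 _ I Ng; rewrite invgK.
  - by rewrite /B /= zx mulVg; case: (sN n).
  exists [seq w * (x^-1 * twist d x) | w <- s0, d <- s].
    by rewrite size_allpairs leq_mul.
  move=> v _; have [w ws Nv] := cov0 v I.
  have [d Nd] : U n (x * (w^-1 * v)).
    by apply: Un0; exists 1; rewrite twist1 mulKg.
  have [d' d's Bd] := covs d I; exists (w * (x^-1 * twist d' x)).
    exact: allpairs_f.
  have Bd' : N n (x^-1 * twist (d'^-1 * d) x) by [].
  have := NM _ _ (coset_twist d' (nN n) Bd') Nd.
  by rewrite -twistM mulVKg !gnorm.
pose D := (c * ((C0 * (e * 2 ^ n0) ^ h2) * (C * e ^ h1.-1)))%N.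
have [s les /(spread_leq (sN D) (cov D)) les'] := spr D.
have : (2 ^ D * 2 ^ (D * h1.-1) <= D * 2 ^ (D * h1.-1))%N.
  rewrite -expnD -mulnS prednK //.
  apply: (@leq_trans (2 ^ (D * h2))); first by rewrite leq_exp2l // leq_mul2l leh orbT.
  apply: leq_trans les _; rewrite {1}/D -!mulnA leq_mul2l; apply/orP; right.
  by apply: leq_trans les' _; rewrite (expnMn e (2 ^ D)) -expnM -!mulnA.
by rewrite leq_pmul2r ?expn_gt0 // leqNgt ltn_expl.
Qed.

End TwistedAction.

(** * Cardinals in the extended rationals *)

Section Ecard.
Local Open Scope ereal_scope.

Lemma ecard_fin (T : choiceType) (A : set T) : finite_set A ->
  ecard A = (#|` fset_set A|%:R)%:E.
Proof. by rewrite /ecard; case: asboolP. Qed.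

Lemma ecard_infin (T : choiceType) (A : set T) : ~ finite_set A -> ecard A = +oo.
Proof. by rewrite /ecard; case: asboolP. Qed.

Lemma finite_image_inj (T U : choiceType) (f : T -> U) (A : set T) : set_inj A f ->
  finite_set (f @` A) = finite_set A.
Proof. by move=> /inj_card_eq/eq_finite_set. Qed.

Lemma ecard_image (T U : choiceType) (f : T -> U) (A : set T) : set_inj A f ->
  ecard (f @` A) = ecard A.
Proof.
move=> injf; rewrite /ecard finite_image_inj //; case: asboolP => // finA.
rewrite fset_set_image // card_in_imfset // => x y.
by rewrite !in_fset_set //; apply: injf.
Qed.

Lemma ecardU (T : choiceType) (A B : set T) : A `&` B = set0 ->
  ecard (A `|` B) = ecard A + ecard B.
Proof.
move=> AB0; rewrite /ecard finite_setU.
case: asboolP => [[finA finB]|nfin]; last first.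
  case: asboolP => [finA|_]; last by case: asboolP.
  by case: asboolP => // finB; case: nfin.
rewrite !asboolT // -EFinD -natrD fset_setU // cardfsU -fset_setI // AB0.
by rewrite fset_set0 cardfs0 subn0.
Qed.

Lemma cardfs_fsetM (T U : choiceType) (X : {fset T}) (Y : {fset U}) :
  #|` (X `*` Y)%fset| = (#|` X| * #|` Y|)%N.
Proof.
rewrite -(size_allpairs pair); apply: perm_size; apply: uniq_perm; first exact: fset_uniq.
  by apply: allpairs_uniq; rewrite ?fset_uniq // => -[? ?] [? ?] _ _ [-> ->].
move=> [x y]; rewrite in_fsetM /=; apply/idP/allpairsP => [/andP[xX yY]|].
  by exists (x, y).
by move=> [[x' y'] [/= xX yY [-> ->]]]; rewrite xX yY.
Qed.

Lemma ecard_bigcup (I T : choiceType) (D : set I) (F : I -> set T) :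
  finite_set D -> trivIset D F ->
  \sum_(i \in D) ecard (F i) = ecard (\bigcup_(i in D) F i).
Proof.
move=> finD; have /finite_seqP[s0 Ds0] := finD.
have [s us ->] : exists2 s, uniq s & D = [set` s].
  exists (undup s0); first exact: undup_uniq.
  by rewrite Ds0; apply/seteqP; split=> i /=; rewrite mem_undup.
rewrite -fsbig_seq //; elim: s us => [_ _|i s IHs /= /andP[nis us] tF].
  by rewrite big_nil set_nil bigcup_set0 ecard_fin ?fset_set0 // cardfs0.
rewrite big_cons IHs //; last first.
  by move=> j k js ks; apply: tF; rewrite /= inE ?js ?ks orbT.
rewrite (bigcup_seq (i :: s)) big_cons -bigcup_seq ecardU //; apply/seteqP; split=> // x [Fi [j js Fj]].
have ij : i = j by apply: tF; [rewrite /= mem_head|rewrite /= inE [_ \in _]js orbT|exists x].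
by move: nis; rewrite ij [_ \in _]js.
Qed.

End Ecard.

(** * Orbits of a normal subgroup of finite index *)

Section Averaging.
Variables (Pi1 Pi2 : groupType).
Variables (Gamma1 : groupClosed Pi1) (Gamma2 : groupClosed Pi2).
Hypotheses (nGamma1 : normal_in Gamma1 predT) (nGamma2 : normal_in Gamma2 predT).
Variables (phi psi : {multiplicative Pi1 -> Pi2}).
Hypotheses (phiGamma : {in Gamma1, forall x, phi x \in Gamma2})
           (psiGamma : {in Gamma1, forall x, psi x \in Gamma2}).
Implicit Types (a b : Pi2) (c d k : Pi1).

Local Notation act := (twist phi psi).
Local Notation tau_restr b := (tau nGamma2 b \o restr phiGamma).

Definition suborbit a : set Pi2 := [set act k a | k in [set` Gamma1]].

Lemma suborbit_refl a : suborbit a a.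
Proof. by exists 1; [exact: gpred1|rewrite twist1]. Qed.

Lemma suborbit_twist k a : k \in Gamma1 -> suborbit (act k a) = suborbit a.
Proof.
move=> kG; apply/seteqP; split=> _ [d /= dG <-].
  by exists (d * k); [exact: gpredM|rewrite twistM].
exists (d * k^-1); rewrite /= ?twistM ?twistK //.
by rewrite gpredM // gpredV.
Qed.

Lemma suborbit_eq a b : suborbit a = suborbit b ->
  exists2 k, k \in Gamma1 & b = act k a.
Proof. by move=> E; have := suborbit_refl b; rewrite -E => -[k kG <-]; exists k. Qed.

Lemma coset_suborbit a k : k \in Gamma1 -> a^-1 * act k a \in Gamma2.
Proof.
move=> kG; rewrite /twist !mulgA gpredM ?gpredV ?phiGamma //.
by rewrite -{2}[a]invgK; apply: nGamma2.2 => //; apply: psiGamma.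
Qed.

Lemma mem_cosetP a A b : cosets_in Gamma2 predT A -> A b ->
  A a <-> a * b^-1 \in Gamma2.
Proof.
move=> [x _ <-] [k /= kG <-]; rewrite invgM mulgA.
have conj y : (x * y * x^-1 \in Gamma2) = (y \in Gamma2).
  apply/idP/idP => yG; last exact: nGamma2.2.
  by have := nGamma2.2 _ x^-1 yG isT; rewrite !gnorm.
split=> [[l lG <-]|].
  by rewrite -[x * l * k^-1]mulgA conj gpredM // gpredV.
move=> aG; exists (x^-1 * a); last by rewrite mulVKg.
by rewrite -(gpredMr _ (_ : k^-1 \in Gamma2)) ?gpredV //= -conj !gnorm.
Qed.

(** The classes of [(tau_b phi', psi')] are the [Gamma1]-orbits inside the coset
    of [b], through right multiplication by [b]. *)
Definition shift b (E : set (subg Gamma2)) : set Pi2 :=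
  [set val x * b | x in E].

Lemma shift_inj b : injective (shift b).
Proof.
move=> E E' eqE; apply/seteqP; split=> x Ex.
  have : shift b E (val x * b) by exists x.
  by rewrite eqE => -[y Ey /mulIg/val_inj <-].
have : shift b E' (val x * b) by exists x.
by rewrite -eqE => -[y Ey /mulIg/val_inj <-].
Qed.

Lemma twist_tau b (c : subg Gamma1) (x : subg Gamma2) :
  val (twist (tau_restr b) (restr psiGamma) c x) * b = act (val c) (val x * b).
Proof. by rewrite /twist /= !invgM !invgK !mulgA mulgVK. Qed.

Lemma shift_class b (x : subg Gamma2) :
  shift b [set y | reidemeister_rel (tau_restr b) (restr psiGamma) x y] =
  suborbit (val x * b).
Proof.
apply/seteqP; split=> [_ [y [c ->] <-]|_ [k kG <-]].
  by rewrite -/(twist _ _ c x) twist_tau; exists (val c) => //; exact: valP.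
pose c : subg Gamma1 := Sub k kG.
exists (twist (tau_restr b) (restr psiGamma) c x); first by exists c.
by rewrite twist_tau SubK.
Qed.

Lemma shift_classes A b : cosets_in Gamma2 predT A -> A b ->
  shift b @` reidemeister_classes (tau_restr b) (restr psiGamma) =
  suborbit @` A.
Proof.
move=> cA Ab; apply/seteqP; split=> [_ [_ [x _ <-] <-]|_ [a Aa <-]].
  rewrite shift_class; exists (val x * b) => //.
  by apply/(mem_cosetP _ cA Ab); rewrite mulgK; exact: valP.
have /(mem_cosetP _ cA Ab) abG := Aa.
pose x : subg Gamma2 := Sub (a * b^-1) abG.
exists [set y | reidemeister_rel (tau_restr b) (restr psiGamma) x y].
  by exists x.
by rewrite shift_class SubK mulgVK.
Qed.

Lemma ecard_suborbits (rep : set Pi2 -> Pi2) :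
  finite_set (cosets_in Gamma2 predT) ->
  (forall A, cosets_in Gamma2 predT A -> A (rep A)) ->
  (\sum_(A \in cosets_in Gamma2 predT)
     reidemeister (tau_restr (rep A)) (restr psiGamma))%E = ecard (range suborbit).
Proof.
move=> fin2 repP.
have cosetE a : exists2 A, cosets_in Gamma2 predT A & A a.
  exists [set a * k | k in [set` Gamma2]]; first by exists a.
  by exists 1; [exact: gpred1|rewrite mulg1].
transitivity (\sum_(A \in cosets_in Gamma2 predT) ecard (suborbit @` A))%E.
  apply: eq_fsbigr => A; rewrite inE => cA; rewrite /reidemeister.
  rewrite -(shift_classes cA (repP A cA)) [RHS]ecard_image // => E E' _ _.
  exact: shift_inj.
rewrite ecard_bigcup //; last first.
  move=> A B cA cB [_ [[a Aa <-] [b Bb /suborbit_eq[k kG]]]] aE.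
  have aBA : b^-1 * a \in Gamma2 by rewrite aE coset_suborbit.
  have cos y C : cosets_in Gamma2 predT C -> C y ->
      C = [set y * k | k in [set` Gamma2]].
    move=> [x _ <-] [l /= lG <-]; apply: coset_eq.
    by rewrite invgM mulgVK gpredV.
  by rewrite (cos _ _ cA Aa) (cos _ _ cB Bb); apply: coset_eq.
congr ecard; apply/seteqP; split=> [_ [A _ [a _ <-]]|_ [a _ <-]].
  by exists a.
by have [A cA Aa] := cosetE a; exists A => //; exists a.
Qed.

Lemma twist_stabX n c a : act c a = a -> act (c ^+ n) a = a.
Proof.
by move=> ca; elim: n => [|n IHn]; rewrite ?twist1 // expgS twistM IHn.
Qed.

(** Since [Gamma1] has finite index and no torsion, a non-trivial stabiliser
    would meet it in an element of infinite order. *)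
Lemma suborbits_free : torsion_free Pi1 ->
  polycyclic (subg Gamma1) -> polycyclic (subg Gamma2) ->
  hirsch_length (subg Gamma1) = hirsch_length (subg Gamma2) ->
  finite_set (cosets_in Gamma1 predT) -> finite_set (range suborbit) ->
  forall c a, act c a = a -> c = 1.
Proof.
move=> tf pc1 pc2 hE /finite_cosetsP[q cov] fin c a ca.
have [i [j [/subnKC <-]]] := covered_pigeonhole (u := fun n => c ^+ n)
  (subgroup_groupClosed Gamma1) cov (fun _ => isT).
rewrite addSnnS expgnDr mulKg; set n := _.+1 => cnG.
pose A := [set a * k | k in [set` Gamma2]].
have cA : cosets_in Gamma2 predT A by exists a.
have Aa : A a by exists 1; [exact: gpred1|rewrite mulg1].
pose f : {multiplicative subg Gamma1 -> subg Gamma2} := tau_restr a.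
pose g : {multiplicative subg Gamma1 -> subg Gamma2} := restr psiGamma.
have finA : finite_set (reidemeister_classes f g).
  rewrite -(finite_image_inj (f := shift a)); last by move=> ? ? _ _; apply: shift_inj.
  rewrite (shift_classes cA Aa); apply: sub_finite_set fin.
  by move=> _ [b _ <-]; exists b.
pose z : subg Gamma1 := Sub (c ^+ n) cnG.
have za : twist f g z 1 = 1.
  apply: val_inj; apply: (mulIg a); rewrite (twist_tau a z 1) /=.
  by rewrite mul1g twist_stabX.
have [|m m0 zm] := finite_orbits_stabiliser (poly_hirsch_length pc1)
  (poly_hirsch_length pc2) _ finA za; first by rewrite hE.
apply: (tf c (n * m)%N); first by rewrite muln_gt0.
have valX l : val (z ^+ l) = c ^+ n ^+ l.
  by elim: l => // l IHl; rewrite (expgS z) (expgS (c ^+ n)) -IHl.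
by rewrite expgnA -valX zm.
Qed.

Local Notation classes := (reidemeister_classes phi psi).
Local Notation class a := [set b | reidemeister_rel phi psi a b].

Lemma class_twist c a : class (act c a) = class a.
Proof.
apply/seteqP; split=> [_ [d ->]|_ [d ->]].
  by exists (d * c); rewrite -/(act _ _) -/(act _ _) twistM.
by exists (d * c^-1); rewrite -/(act _ _) -/(act _ (act c a)) twistM twistK.
Qed.

Lemma xget_class E : classes E -> class (xget 1 E) = E.
Proof.
move=> [a _ <-].
have : class a (xget 1 (class a)).
  by apply: (@xgetI _ _ _ a); exists 1; rewrite -/(act 1 a) twist1.
by move=> [c ->]; rewrite -/(act c a) class_twist.
Qed.

Lemma finite_suborbits : finite_set (cosets_in Gamma1 predT) ->
  finite_set (range suborbit) <-> finite_set classes.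
Proof.
move=> /finite_cosetsP[q [ys _ cov]]; split=> [fin|/orbit_reps[s covs]].
  apply: sub_finite_set (finite_image (fun E => class (xget 1 E)) fin).
  move=> _ [a _ <-]; exists (suborbit a); first by exists a.
  have : suborbit a (xget 1 (suborbit a)) by exact: xgetI (suborbit_refl a).
  by move=> [k _ <-]; rewrite class_twist.
apply: sub_finite_set (finite_image (fun p => suborbit (act p.1 p.2))
  (finite_seq [seq (y, w) | y <- ys, w <- s])).
move=> _ [a _ <-]; have [w ws [c ->]] := covs a; have [y yys yc] := cov c isT.
exists (y, w); first by apply: allpairs_f.
rewrite /= -(suborbit_twist _ (_ : c * y^-1 \in Gamma1)) -?twistM ?mulgVK //.
by have := nGamma1.2 _ y yc isT; rewrite mulVKg.
Qed.

(** A free orbit is a copy of [Pi1], whose [Gamma1]-orbits are right cosets of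
    [Gamma1]; normality makes them left cosets. *)
Lemma ecard_suborbits_free : (forall c a, act c a = a -> c = 1) ->
  ecard (range suborbit) = ecard (classes `*` cosets_in Gamma1 predT).
Proof.
move=> free.
(* [xget] picks a base point in each orbit and an element of each coset; they are
   nonempty, so its default value does not occur *)
pose F (p : set Pi2 * set Pi1) := suborbit (act (xget 1 p.2) (xget 1 p.1)).
have cosE A : cosets_in Gamma1 predT A ->
    A = [set xget 1 A * k | k in [set` Gamma1]].
  move=> [x _ <-]; set B := [set _ | _ in _].
  have : B (xget 1 B).
    by apply: (@xgetI _ _ _ x); exists 1; [exact: gpred1|rewrite mulg1].
  move=> [k kG <-]; apply: coset_eq; by rewrite invgM mulgVK gpredV.
have -> : range suborbit = F @` (classes `*` cosets_in Gamma1 predT).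
  apply/seteqP; split=> [_ [a _ <-]|_ [p _ <-]]; last by eexists.
  have Ea : classes (class a) by exists a.
  have : class (xget 1 (class a)) a.
    by rewrite xget_class //; exists 1; rewrite -/(act 1 a) twist1.
  move=> [d aE]; pose A := [set d * k | k in [set` Gamma1]].
  exists (class a, A); first by split=> //; exists d.
  rewrite /F /=; have : A (xget 1 A).
    by apply: (@xgetI _ _ _ d); exists 1; [exact: gpred1|rewrite mulg1].
  move=> [k /= kG <-]; rewrite [in RHS]aE -/(act d _).
  rewrite -(suborbit_twist (act d _) (nGamma1.2 _ d kG isT)) -twistM.
  by rewrite mulgVK.
rewrite ecard_image // => -[E A] [E' A'] /set_mem[/= cE cA] /set_mem[/= cE' cA'].
rewrite /F /= => /suborbit_eq[k kG]; set w := xget 1 E; set w' := xget 1 E'.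
set c := xget 1 A; set c' := xget 1 A' => E1.
have EE : E = E'.
  rewrite -(xget_class cE) -(xget_class cE') -/w -/w'.
  by rewrite -(class_twist c' w') E1 !class_twist.
have ww : w' = w by rewrite /w /w' EE.
have : act (c'^-1 * (k * c)) w = w by rewrite !twistM -E1 ww twistK.
move=> /free/mulg1_eq; rewrite invgK => c'E.
rewrite EE (cosE A) // (cosE A') // -/c -/c'; congr (_, _); apply: coset_eq.
rewrite c'E invgM -mulgA -{2}[c]invgK mulgA.
by apply: nGamma1.2 => //; rewrite gpredV.
Qed.

End Averaging.

Local Close Scope group_scope.
Local Open Scope ereal_scope.

Theorem corollary1p3
  (Pi1 Pi2 : groupType)
  (Gamma1 : groupClosed Pi1) (Gamma2 : groupClosed Pi2)
  (tfPi1 : torsion_free Pi1) (tfPi2 : torsion_free Pi2)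
  (nGamma1 : normal_in Gamma1 predT) (nGamma2 : normal_in Gamma2 predT)
  (pcGamma1 : polycyclic (subg Gamma1)) (pcGamma2 : polycyclic (subg Gamma2))
  (finPi1 : finite_set (cosets_in Gamma1 predT))
  (finPi2 : finite_set (cosets_in Gamma2 predT))
  (phi psi : {multiplicative Pi1 -> Pi2})
  (phiGamma : {in Gamma1, forall x, phi x \in Gamma2})
  (psiGamma : {in Gamma1, forall x, psi x \in Gamma2})
  (hirsch_eq : hirsch_length (subg Gamma1) = hirsch_length (subg Gamma2))
  (* a choice of alpha for each coset in Pi2 / Gamma2 *)
  (rep : set Pi2 -> Pi2)
  (repP : forall A, cosets_in Gamma2 predT A -> A (rep A)) :
  reidemeister phi psi =
    ((index_in Gamma1 predT)%:R^-1)%:E *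
    \sum_(A \in cosets_in Gamma2 predT)
      reidemeister (tau nGamma2 (rep A) \o restr phiGamma) (restr psiGamma).
Proof.
rewrite ecard_suborbits //.
have i0 : ((index_in Gamma1 predT)%:R != 0 :> rat)%R.
  rewrite pnatr_eq0 cardfs_eq0; apply/eqP => /(congr1 (fun X => [set` X])).
  rewrite fset_setK // set_fset0 => /seteqP[+ _].
  by move=> /(_ [set 1 * k | k in [set` Gamma1]])%g; apply; exists 1%g.
have [fin|inf] := pselect (finite_set (range (suborbit Gamma1 phi psi))).
  have fincl := (finite_suborbits nGamma1 phi psi finPi1).1 fin.
  rewrite (ecard_suborbits_free nGamma1); last first.
    exact: (suborbits_free nGamma2 phiGamma psiGamma tfPi1 pcGamma1 pcGamma2 hirsch_eq).
  rewrite /reidemeister !ecard_fin //; last exact: finite_setX.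
  rewrite fset_setX // cardfs_fsetM -EFinM natrM mulrC -mulrA.
  by rewrite divff ?mulr1.
rewrite /reidemeister !ecard_infin //; last first.
  by move=> /(finite_suborbits nGamma1 phi psi finPi1).2.
by rewrite gt0_muley // lte_fin invr_gt0 lt0r i0 ler0n.
Qed.
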